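(* For every integer $k\ge 0$, the $k$-bend FM-bigraph problem is at least as hard as the $(2k+1)$-BPSEWC problem, i.e., $(2k+1)$-BPSEWC reduces in polynomial time to the $k$-bend FM-bigraph problem.
   Context: An FM-bigraph (fixed-mobile bigraph) is a pair $\langle G,\phi\rangle$, where $G=(V_f,V_m,E)$ is a planar bipartite graph with partition sets $V_f$ (fixed vertices) and $V_m$ (mobile vertices), and $\phi:V_f\to\mathbb{R}^2$ maps the vertices of $V_f$ to pairwise distinct points. A planar $k$-bend drawing of $\langle G,\phi\rangle$ is a crossing-free drawing of $G$ in the plane in which vertices are distinct points, each $v\in V_f$ is placed at $\phi(v)$, the vertices of $V_m$ may be placed freely, and each edge is a simple poly-line with at most $k$ bends. The $k$-bend FM-bigraph problem asks, given a planar FM-bigraph $\langle G,\phi\rangle$, whether it has a planar $k$-bend drawing. The $b$-BPSEWC problem ($b$-bend point set embeddability with correspondence) is: given a planar graph $G=(V,E)$, a set $S$ of $|V|$ points in the plane, and a one-to-one correspondence $\zeta$ between $V$ and $S$, is there a planar drawing of $G$ in which each vertex $v$ is placed at the point $\zeta(v)$ and each edge is a poly-line with at most $b$ bends? *)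

(* Defs.v *)
From HB Require Import structures.
From mathcomp Require Import all_boot all_order all_algebra finmap.
From mathcomp Require Import classical_sets reals topology normedtype.

Set Implicit Arguments.
Unset Strict Implicit.
Unset Printing Implicit Defensive.

Import Order.TTheory GRing.Theory Num.Theory.
Import numFieldNormedType.Exports.

Local Open Scope ring_scope.

(** * Graphs *)

Record sgraph := SGraph {
  vertex :> finType;
  adj : rel vertex;
  adj_sym : symmetric adj;
  adj_irrefl : irreflexive adj }.

Record bigraph := BiGraph {
  fixed : finType;
  mobile : finType;
  bedge : fixed -> mobile -> bool }.

Definition bigraph_adj (B : bigraph) : rel (fixed B + mobile B) :=
  fun x y => match x, y with
             | inl u, inr w => bedge u w
             | inr w, inl u => bedge u w
             | _, _ => false
             end.

Lemma bigraph_adj_sym (B : bigraph) : symmetric (@bigraph_adj B).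
Proof. by case=> ? []. Qed.

Lemma bigraph_adj_irrefl (B : bigraph) : irreflexive (@bigraph_adj B).
Proof. by case. Qed.

Definition bigraph_graph (B : bigraph) : sgraph :=
  SGraph (@bigraph_adj_sym B) (@bigraph_adj_irrefl B).

(** * Drawings in the plane *)

Section Drawings.
Variable R : realType.
Implicit Types (G : sgraph) (a b : R * R) (q : seq (R * R)).

Definition is_arc a b (A : set (R * R)) : Prop :=
  exists gamma : R -> R * R,
    [/\ {within [set t | 0 <= t <= 1], continuous gamma}%classic,
        {in [pred t | 0 <= t <= 1] &, injective gamma},
        gamma 0 = a, gamma 1 = b &
        A = [set gamma t | t in [set t | 0 <= t <= 1]]%classic].

(** The point at parameter [t] of the [i]-th segment of the poly-line whose
    successive corners (end points included) are [q]. *)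
Definition polyline_point q (i : nat) (t : R) : R * R :=
  let a := nth (0, 0) q i in let b := nth (0, 0) q i.+1 in
  (a.1 + t * (b.1 - a.1), a.2 + t * (b.2 - a.2)).

Definition polyline q : set (R * R) :=
  [set p | exists i t,
     [/\ (i.+1 < size q)%N, 0 <= t <= 1 & p = polyline_point q i t]]%classic.

(** The poly-line is traversed by the parameter [i + t], which ranges over
    [0, size q - 1]; simplicity is injectivity of this traversal.  In
    particular no segment is degenerate. *)
Definition simple_polyline q : Prop :=
  forall i j s t, (i.+1 < size q)%N -> (j.+1 < size q)%N ->
    0 <= s <= 1 -> 0 <= t <= 1 ->
    polyline_point q i s = polyline_point q j t -> i%:R + s = j%:R + t.

Definition is_polyline (k : nat) a b (A : set (R * R)) : Prop :=
  exists bends : seq (R * R),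
    [/\ (size bends <= k)%N, simple_polyline (a :: rcons bends b) &
        A = polyline (a :: rcons bends b)].

(** [trace u v] is the point set representing the edge [uv]; it is only
    relevant when [adj u v] holds. *)
Record crossing_free G (pos : G -> R * R) (trace : G -> G -> set (R * R)) :
    Prop := CrossingFree {
  cf_pos : injective pos;
  cf_sym : forall u v, adj u v -> trace v u = trace u v;
  cf_vertex : forall u v w, adj u v -> trace u v (pos w) -> w = u \/ w = v;
  cf_edge : forall u v x y p, adj u v -> adj x y ->
    ([set u; v] != [set x; y])%SET -> trace u v p -> trace x y p ->
    exists2 w, (w \in [set u; v] :&: [set x; y])%SET & p = pos w }.

Definition planar G : Prop :=
  exists (pos : G -> R * R) (trace : G -> G -> set (R * R)),
    crossing_free pos trace /\
    forall u v, adj u v -> is_arc (pos u) (pos v) (trace u v).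

Definition polyline_drawing (k : nat) G (pos : G -> R * R)
    (trace : G -> G -> set (R * R)) : Prop :=
  crossing_free pos trace /\
  forall u v, adj u v -> is_polyline k (pos u) (pos v) (trace u v).

Record fm_bigraph := FMBigraph {
  fm_graph :> bigraph;
  fm_planar : planar (bigraph_graph fm_graph);
  fm_loc : fixed fm_graph -> R * R;
  fm_loc_inj : injective fm_loc }.

Definition fm_drawable (k : nat) (F : fm_bigraph) : Prop :=
  exists (pos : bigraph_graph F -> R * R)
         (trace : bigraph_graph F -> bigraph_graph F -> set (R * R)),
    (forall v : fixed F, pos (inl v) = fm_loc v) /\
    polyline_drawing k pos trace.

Record bpsewc := BPSEWC {
  bp_graph :> sgraph;
  bp_planar : planar bp_graph;
  bp_points : {fset (R * R)%type};
  bp_points_card : #|` bp_points| = #|bp_graph|;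
  bp_corr : bp_graph -> R * R;
  bp_corr_inj : injective bp_corr;
  bp_corr_points : forall v, bp_corr v \in bp_points }.

Definition bpsewc_drawable (b : nat) (I : bpsewc) : Prop :=
  exists (pos : bp_graph I -> R * R)
         (trace : bp_graph I -> bp_graph I -> set (R * R)),
    (forall v, pos v = bp_corr v) /\ polyline_drawing b pos trace.

End Drawings.

(** * Turing machines *)

Inductive move := MoveLeft | Stay | MoveRight.

(** A two-way infinite tape is a pair [(l, r)]: [l] lists the cells to the left
    of the head, nearest first, and [r] the scanned cell and those to its
    right.  Cells not listed are blank ([None]). *)
Section Tapes.
Variable T : Type.
Notation cell := (option T).
Notation tape := (seq cell * seq cell)%type.

Definition blank_tape : tape := ([::], [::]).
Definition word_tape (w : seq T) : tape := ([::], map Some w).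
Definition tape_read (tp : tape) : cell := head None tp.2.
Definition tape_write (c : cell) (tp : tape) : tape := (tp.1, c :: behead tp.2).
Definition tape_move (m : move) (tp : tape) : tape :=
  match m with
  | MoveLeft => (behead tp.1, head None tp.1 :: tp.2)
  | Stay => tp
  | MoveRight => (head None tp.2 :: tp.1, behead tp.2)
  end.
Definition tape_act (a : cell * move) (tp : tape) : tape :=
  tape_move a.2 (tape_write a.1 tp).

Definition tape_holds (w : seq T) (tp : tape) : Prop :=
  exists m n, catrev tp.1 tp.2 = nseq m None ++ map Some w ++ nseq n None.

End Tapes.

(** Deterministic machines over the input alphabet [A] with [tm_tapes.+1]
    tapes; the tape alphabet is [A] together with the symbols of [tm_extra].
    The input is on the first tape, the output on the last one. *)
Record turing_machine (A : finType) := TuringMachine {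
  tm_tapes : nat;
  tm_extra : finType;
  tm_state : finType;
  tm_start : tm_state;
  tm_halt : pred tm_state;
  tm_trans : tm_state -> tm_tapes.+1.-tuple (option (A + tm_extra)) ->
             tm_state * tm_tapes.+1.-tuple (option (A + tm_extra) * move) }.

Section Runs.
Variables (A : finType) (M : turing_machine A).
Notation symb := (A + tm_extra M)%type.
Notation tape := (seq (option symb) * seq (option symb))%type.

Definition tm_config : Type := tm_state M * (tm_tapes M).+1.-tuple tape.

Definition tm_init (w : seq A) : tm_config :=
  (tm_start M,
   [tuple of word_tape (map inl w) :: [tuple of nseq (tm_tapes M) (blank_tape symb)]]).

Definition tm_step (c : tm_config) : tm_config :=
  if tm_halt c.1 then c else
  let r := tm_trans c.1 (map_tuple (@tape_read symb) c.2) in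
  (r.1, map_tuple (fun x => tape_act x.1 x.2) (zip_tuple r.2 c.2)).

Definition tm_computes_in (n : nat) (w w' : seq A) : Prop :=
  let c := iter n tm_step (tm_init w) in
  tm_halt c.1 /\ tape_holds (map inl w') (tnth c.2 ord_max).

End Runs.

(** * Decision problems and polynomial-time many-one reductions *)

Record decision_problem (A : finType) := DecisionProblem {
  instance : Type;
  encode : instance -> seq A;
  yes : instance -> Prop }.

Definition poly_reducible (A : finType) (P Q : decision_problem A) : Prop :=
  exists f : instance P -> instance Q,
    (exists (M : turing_machine A) (c d : nat), forall x,
       exists2 n : nat, (n <= c * size (encode x) ^ d + c)%N &
         tm_computes_in M n (encode x) (encode (f x))) /\
    (forall x, yes x <-> yes (f x)).

(** * Finite encodings

    Machine inputs have rational points, written with binary numerators and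
    denominators.  Vertices are numbered from 0 and vertex numbers are written
    in unary; as every vertex contributes at least one symbol to the encoding,
    this is polynomially equivalent to writing them in binary. *)

Inductive symbol := Zero | One | Minus | Slash | Comma | Semicolon | Bar.

Definition symbol_code (s : symbol) : 'I_7 :=
  inord match s with
        | Zero => 0 | One => 1 | Minus => 2 | Slash => 3 | Comma => 4
        | Semicolon => 5 | Bar => 6
        end.
Definition symbol_decode (i : 'I_7) : symbol :=
  nth Zero [:: Zero; One; Minus; Slash; Comma; Semicolon; Bar] i.
Lemma symbol_codeK : cancel symbol_code symbol_decode.
Proof. by case; rewrite /symbol_decode inordK. Qed.

HB.instance Definition _ := Finite.copy symbol (can_type symbol_codeK).

(** Least significant bit first; 0 is the empty word. *)
Fixpoint positive_bits (p : BinNums.positive) : seq symbol :=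
  match p with
  | BinNums.xH => [:: One]
  | BinNums.xO p' => Zero :: positive_bits p'
  | BinNums.xI p' => One :: positive_bits p'
  end.
Definition nat_bits (n : nat) : seq symbol :=
  if bin_of_nat n is BinNums.Npos p then positive_bits p else [::].

Definition enc_rat (x : rat) : seq symbol :=
  (if x < 0 then [:: Minus] else [::]) ++
  nat_bits `|numq x|%N ++ Slash :: nat_bits `|denq x|%N.

Definition enc_point (p : rat * rat) : seq symbol :=
  enc_rat p.1 ++ Comma :: enc_rat p.2 ++ [:: Semicolon].

Definition enc_points n (loc : 'I_n -> rat * rat) : seq symbol :=
  flatten [seq enc_point (loc i) | i <- enum 'I_n].

Definition enc_edges m n (s : seq ('I_m * 'I_n)) : seq symbol :=
  flatten [seq nseq e.1 One ++ Comma :: nseq e.2 One ++ [:: Semicolon]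
          | e : 'I_m * 'I_n <- s].

Section Problems.
Variable R : realType.

Definition real_point (p : rat * rat) : R * R := (ratr p.1, ratr p.2).

Lemma real_point_inj : injective real_point.
Proof. by case=> x y [x' y'] [] /fmorph_inj -> /fmorph_inj ->. Qed.

(** An edge [uv] is listed once, as the pair [(u, v)] with [u < v]. *)
Definition lt_pairs n (s : seq ('I_n * 'I_n)) : bool :=
  all (fun e : 'I_n * 'I_n => e.1 < e.2)%N s.

Definition list_adj n (s : seq ('I_n * 'I_n)) : rel 'I_n :=
  fun u v => ((u, v) \in s) || ((v, u) \in s).

Lemma list_adj_sym n (s : seq ('I_n * 'I_n)) : symmetric (list_adj s).
Proof. by move=> u v; rewrite /list_adj orbC. Qed.

Lemma list_adj_irrefl n (s : seq ('I_n * 'I_n)) :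
  lt_pairs s -> irreflexive (list_adj s).
Proof.
move=> /allP lt_s u; rewrite /list_adj orbb.
by apply/negP => /lt_s /=; rewrite ltnn.
Qed.

Definition list_graph n (s : seq ('I_n * 'I_n))
    (lt_s : lt_pairs s) : sgraph :=
  SGraph (@list_adj_sym n s) (list_adj_irrefl lt_s).

Definition list_bigraph n m (s : seq ('I_n * 'I_m)) : bigraph :=
  @BiGraph 'I_n 'I_m (fun u w => (u, w) \in s).

Record bpsewc_input := BPSEWCInput {
  bpi_order : nat;
  bpi_edges : seq ('I_bpi_order * 'I_bpi_order);
  bpi_edges_uniq : uniq bpi_edges;
  bpi_edges_lt : lt_pairs bpi_edges;
  bpi_planar : planar R (list_graph bpi_edges_lt);
  bpi_points : {fset (rat * rat)%type};
  bpi_points_card : #|` bpi_points| = bpi_order;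
  bpi_corr : 'I_bpi_order -> rat * rat;
  bpi_corr_inj : injective bpi_corr;
  bpi_corr_points : forall v, bpi_corr v \in bpi_points }.

Record fm_input := FMInput {
  fmi_fixed : nat;
  fmi_mobile : nat;
  fmi_edges : seq ('I_fmi_fixed * 'I_fmi_mobile);
  fmi_edges_uniq : uniq fmi_edges;
  fmi_planar : planar R (bigraph_graph (list_bigraph fmi_edges));
  fmi_loc : 'I_fmi_fixed -> rat * rat;
  fmi_loc_inj : injective fmi_loc }.

Section BPSEWCInput.
Variable I : bpsewc_input.

Lemma bpi_real_card :
  #|` (real_point @` bpi_points I)%fset| = #|list_graph (bpi_edges_lt I)|.
Proof.
by rewrite card_imfset ?bpi_points_card ?card_ord //; apply: real_point_inj.
Qed.

Lemma bpi_real_corr_inj : injective (real_point \o @bpi_corr I).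
Proof. exact: inj_comp real_point_inj (@bpi_corr_inj I). Qed.

Lemma bpi_real_corr_points v :
  (real_point \o @bpi_corr I) v \in (real_point @` bpi_points I)%fset.
Proof. by apply: in_imfset; exact: bpi_corr_points. Qed.

Definition bpsewc_of_input : bpsewc R :=
  @BPSEWC R (list_graph (bpi_edges_lt I)) (bpi_planar I) _ bpi_real_card
    _ bpi_real_corr_inj bpi_real_corr_points.

(** The point set is the image of the correspondence, so that listing
    [bpi_corr] describes both, as well as the number of vertices. *)
Definition enc_bpsewc : seq symbol :=
  enc_points (@bpi_corr I) ++ Bar :: enc_edges (bpi_edges I).

End BPSEWCInput.

Section FMInput.
Variable I : fm_input.

Lemma fmi_real_loc_inj : injective (real_point \o @fmi_loc I).
Proof. exact: inj_comp real_point_inj (@fmi_loc_inj I). Qed.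

Definition fm_of_input : fm_bigraph R :=
  @FMBigraph R (list_bigraph (fmi_edges I)) (fmi_planar I) _ fmi_real_loc_inj.

Definition enc_fm : seq symbol :=
  enc_points (@fmi_loc I) ++ Bar :: enc_edges (fmi_edges I)
    ++ Bar :: nseq (fmi_mobile I) One.

End FMInput.

Definition bpsewc_problem (b : nat) : decision_problem symbol :=
  DecisionProblem enc_bpsewc (fun I => bpsewc_drawable b (bpsewc_of_input I)).

Definition fm_problem (k : nat) : decision_problem symbol :=
  DecisionProblem enc_fm (fun I => fm_drawable k (fm_of_input I)).

End Problems.

(* Main.v *)
(** Subdivide every edge [uv] of the given graph by a mobile vertex [w], and let
    the given vertices be fixed at their points.  In a drawing with [2 * k + 1]
    bends per edge, put [w] at the middle bend of [uv] (or at the midpoint, if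
    [uv] is straight): each half has at most [k] bends.  Conversely, two
    poly-lines with at most [k] bends that share only the end point [w] form a
    poly-line with at most [2 * k + 1] bends.  The encoding of edge number [j],
    [1^u,1^v;], becomes [1^u,1^j;1^v,1^j;], which a Turing machine with three
    tapes writes in quadratic time. *)
From HB Require Import structures.
Require Import Defs.
From mathcomp Require Import all_boot all_order all_algebra.
From mathcomp Require Import boolp classical_sets reals topology normedtype.
From mathcomp Require Import ring lra zify.

Set Implicit Arguments.
Unset Strict Implicit.
Unset Printing Implicit Defensive.

Import Order.TTheory GRing.Theory Num.Theory.
Import numFieldNormedType.Exports.

(** * The edge list of the subdivision and its encoding *)

(** The two halves of an edge are consecutive, so that their encoding can be written during a single
    left-to-right reading of the edges. *)
Definition half_edges n (s : seq ('I_n * 'I_n)) : seq ('I_n * 'I_(size s)) :=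
  flatten [seq [:: ((tnth (in_tuple s) j).1, j); ((tnth (in_tuple s) j).2, j)]
          | j <- enum 'I_(size s)].

Lemma mem_half_edges n (s : seq ('I_n * 'I_n)) u j :
  ((u, j) \in half_edges s) =
  (u == (tnth (in_tuple s) j).1) || (u == (tnth (in_tuple s) j).2).
Proof.
apply/flatten_mapP/idP => [[i _]|u_j].
  by rewrite !inE !xpair_eqE => /orP[] /andP[/eqP-> /eqP->]; rewrite eqxx ?orbT.
by exists j; rewrite ?mem_enum// !inE !xpair_eqE eqxx !andbT.
Qed.

(** Halves of different edges differ in the mobile vertex; the two halves of one edge differ in the
    fixed one, as [lt_pairs] excludes loops. *)
Lemma uniq_half_edges n (s : seq ('I_n * 'I_n)) :
  lt_pairs s -> uniq (half_edges s).
Proof.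
move=> /allP lt_s; rewrite /half_edges.
elim: (enum _) (enum_uniq 'I_(size s)) => [//|j e IHe] /= /andP[j_e uniq_e].
have notin_e u : (u, j) \notin flatten
    [seq [:: ((tnth (in_tuple s) i).1, i); ((tnth (in_tuple s) i).2, i)] | i <- e].
  apply: contra j_e => /flatten_mapP[i i_e].
  by rewrite !inE !xpair_eqE => /orP[] /andP[_ /eqP->].
rewrite inE negb_or !notin_e IHe// !andbT xpair_eqE eqxx andbT -val_eqE.
by rewrite neq_ltn lt_s// mem_tnth.
Qed.

Lemma enc_edges_cons m n e (s : seq ('I_m * 'I_n)) :
  enc_edges (e :: s) =
  nseq e.1 One ++ Comma :: nseq e.2 One ++ Semicolon :: enc_edges s.
Proof. by rewrite /enc_edges /= -!catA cat_cons -catA. Qed.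

(** The start index [i] is the value of the machine's counter, which varies in the induction over
    the edges. *)
Definition enc_half_edges n (s : seq ('I_n * 'I_n)) (i : nat) : seq symbol :=
  flatten [seq nseq x.1.1 One ++ Comma :: nseq x.2 One ++ Semicolon ::
               nseq x.1.2 One ++ Comma :: nseq x.2 One ++ [:: Semicolon]
          | x : 'I_n * 'I_n * nat <- zip s (iota i (size s))].

Lemma enc_edges_half_edges n (s : seq ('I_n * 'I_n)) :
  enc_edges (half_edges s) = enc_half_edges s 0.
Proof.
have zipE : zip s (iota 0 (size s)) =
    [seq (tnth (in_tuple s) j, val j) | j <- enum 'I_(size s)].
  rewrite -val_enum_ord -[X in zip X _]/(val (in_tuple s)).
  rewrite -[X in zip X _](map_tnth_enum (in_tuple s)) /=.
  by elim: (enum _) => //= j e ->.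
rewrite /enc_edges /half_edges /enc_half_edges zipE -map_comp.
elim: (enum _) => //= j e ->.
by rewrite -!catA /= -!catA /= -!catA /= -!catA.
Qed.

(** * The Turing machine *)

(** The tapes are the input, a counter holding the index [j] of the current edge
    in unary, and the output.  In [Source] and [Target] the machine copies the
    two ends of the edge; after each of them it copies the counter, from left
    to right in [CounterRight] and back in [CounterLeft], so that the head ends
    on the blank left of the counter, where a [One] is written to pass to
    [j.+1].  In the end the counter is the number of mobile vertices, which is
    copied in [Mobile]. *)
Inductive phase :=
  Points | Source | CounterRight | Target | CounterLeft | Mobile | Done.

Definition phase_code (p : phase) : 'I_7 :=
  inord match p with
        | Points => 0 | Source => 1 | CounterRight => 2 | Target => 3
        | CounterLeft => 4 | Mobile => 5 | Done => 6
        end.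
Definition phase_decode (i : 'I_7) : phase :=
  nth Points [:: Points; Source; CounterRight; Target; CounterLeft; Mobile; Done] i.
Lemma phase_codeK : cancel phase_code phase_decode.
Proof. by case; rewrite /phase_decode inordK. Qed.

HB.instance Definition _ := Finite.copy phase (can_type phase_codeK).

Local Notation cell := (option (symbol + void)).
Local Notation tape := (seq cell * seq cell)%type.
Local Notation mark x := (Some (inl x) : cell).

Definition emit (p : phase) (a b : cell * move) (o : symbol) :
    phase * 3.-tuple (cell * move) :=
  (p, [tuple a; b; (mark o, MoveRight)]).

Definition subdivider_trans (p : phase) (x : 3.-tuple cell) :
    phase * 3.-tuple (cell * move) :=
  let i := nth None x 0 in let c := nth None x 1 in
  match p with
  | Points => match i with
              | Some (inl Bar) => emit Source (i, MoveRight) (c, Stay) Bar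
              | Some (inl o) => emit Points (i, MoveRight) (c, Stay) o
              | _ => emit Done (i, Stay) (c, Stay) Bar
              end
  | Source => match i with
              | Some (inl Comma) => emit CounterRight (i, MoveRight) (c, Stay) Comma
              | Some _ => emit Source (i, MoveRight) (c, Stay) One
              | None => emit Mobile (i, Stay) (c, Stay) Bar
              end
  | CounterRight => if c then emit CounterRight (i, Stay) (c, MoveRight) One
                    else emit Target (i, Stay) (c, MoveLeft) Semicolon
  | Target => match i with
              | Some (inl Semicolon) => emit CounterLeft (i, MoveRight) (c, Stay) Comma
              | _ => emit Target (i, MoveRight) (c, Stay) One
              end
  | CounterLeft => if c then emit CounterLeft (i, Stay) (c, MoveLeft) One
                   else emit Source (i, Stay) (mark One, Stay) Semicolon
  | Mobile => if c then emit Mobile (i, Stay) (c, MoveRight) One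
              else (Done, [tuple (i, Stay); (c, Stay); (None, Stay)])
  | Done => emit Done (i, Stay) (c, Stay) Bar
  end.

Definition subdivider : turing_machine symbol :=
  @TuringMachine symbol 2 void phase Points (fun p => if p is Done then true else false)
    subdivider_trans.

(** Nothing is listed to the right of the output head, since [emit] fills a fresh cell and moves on.
    The cells written are stored nearest first, whence the [catrev] in the lemmas on runs. *)
Definition cfg (p : phase) (i c : tape) (o : seq cell) : tm_config subdivider :=
  (p, [tuple i; c; (o, [::])]).

(** * Runs of the machine, phase by phase *)

Local Notation marks w := (map (fun x => mark x) w).
Local Notation ones j := (nseq j (mark One)).
Local Notation blanks j := (nseq j (None : cell)).
Local Notation run n := (iter n (@tm_step _ subdivider)).

(** Comparing the sequences under the tuples lets single steps be checked by computation. *)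
Lemma config_eq (c c' : tm_config subdivider) :
  c.1 = c'.1 -> val c.2 = val c'.2 -> c = c'.
Proof. by case: c c' => [p t] [p' t'] /= -> /val_inj ->. Qed.

Lemma catrev_ones j (z : seq cell) : catrev (ones j) z = ones j ++ z.
Proof. by rewrite catrevE rev_nseq. Qed.

Lemma run_step n c c' d : tm_step c = c' -> run n c' = d -> run n.+1 c = d.
Proof. by move=> <- <-; rewrite iterSr. Qed.

(** Rewriting the scanned counter cell turns an unlisted blank into an explicit [None], hence
    [head None c.2 :: behead c.2]. *)
Lemma run_points w l r c o : Bar \notin w ->
  run (size w).+1 (cfg Points (l, marks w ++ mark Bar :: r) c o) =
  cfg Source (catrev (marks (rcons w Bar)) l, r) (c.1, head None c.2 :: behead c.2)
    (catrev (marks (rcons w Bar)) o).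
Proof.
elim: w l c o => [|x w IHw] l c o; first by move=> _; apply: config_eq.
rewrite inE negb_or => /andP[Bar_x Bar_w].
apply: run_step (IHw _ (c.1, head None c.2 :: behead c.2) _ Bar_w).
by case: x Bar_x => [||||||]; rewrite ?eqxx // => _; apply: config_eq.
Qed.

Lemma run_source u l r lc x rc o :
  run u.+1 (cfg Source (l, ones u ++ mark Comma :: r) (lc, x :: rc) o) =
  cfg CounterRight (mark Comma :: catrev (ones u) l, r) (lc, x :: rc)
    (mark Comma :: catrev (ones u) o).
Proof.
elim: u l o => [|u IHu] l o; first by apply: config_eq.
by apply: run_step (IHu _ _); apply: config_eq.
Qed.

Lemma run_target u l r lc x rc o :
  run u.+1 (cfg Target (l, ones u ++ mark Semicolon :: r) (lc, x :: rc) o) =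
  cfg CounterLeft (mark Semicolon :: catrev (ones u) l, r) (lc, x :: rc)
    (mark Comma :: catrev (ones u) o).
Proof.
elim: u l o => [|u IHu] l o; first by apply: config_eq.
by apply: run_step (IHu _ _); apply: config_eq.
Qed.

(** From the blank after the counter the head steps back onto the last [One], or, if [j] is 0, onto
    the blank left of the counter, where [CounterLeft] stops at once. The predecessor in [b.-1]
    accounts for the blank that was scanned, whether or not it was listed before. *)
Lemma run_counter_right j x i l lc b o :
  run j.+1 (cfg CounterRight (i, x :: l) (lc, ones j ++ blanks b) o) =
  cfg Target (i, x :: l)
    (behead (catrev (ones j) lc), head None (catrev (ones j) lc) :: None :: blanks b.-1)
    (mark Semicolon :: catrev (ones j) o).
Proof.
elim: j lc o => [|j IHj] lc o; first by case: b => [|b]; apply: config_eq.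
by apply: run_step (IHj _ _); apply: config_eq.
Qed.

(** The initial counter tape has the form left by [run_counter_right]. The new [One] replaces a
    blank on the left, whence [a.-1], and the head ends on it, ready for the next pass to the
    right. *)
Lemma run_counter_left j i l a r o :
  let lc := ones j ++ blanks a in
  run j.+1 (cfg CounterLeft (i, l) (behead lc, head None lc :: r) o) =
  cfg Source (i, head None l :: behead l) (blanks a.-1, mark One :: catrev (ones j) r)
    (mark Semicolon :: catrev (ones j) o).
Proof.
elim: j l r o => [|j IHj] l r o /=; first by case: a => [|a]; apply: config_eq.
by apply: run_step (IHj (head None l :: behead l) (mark One :: r) _); apply: config_eq.
Qed.

Lemma run_mobile j i l lc b o :
  exists c i', run j.+1 (cfg Mobile (i, l) (lc, ones j ++ blanks b) o) =
    (Done, [tuple i'; c; (catrev (ones j) o, [:: None])]).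
Proof.
elim: j l lc o => [|j IHj] l lc o.
  by do 2!eexists; case: b => [|b]; apply: config_eq.
have [c [i' run_j]] := IHj (head None l :: behead l) (mark One :: lc) (mark One :: o).
by exists c, i'; apply: run_step run_j; apply: config_eq.
Qed.

Lemma run_trans m n c c' d : run m c = c' -> run n c' = d -> run (m + n) c = d.
Proof. by move=> <- <-; rewrite addnC iterD. Qed.

(** The existential variables absorb the part of the input already read and the numbers of listed
    blanks. *)
Lemma run_edge u v j w l a b d o : exists l' a' d',
  run (u.+1 + (j.+1 + (v.+1 + j.+1)))
    (cfg Source
      (l, marks (nseq u One ++ Comma :: nseq v One ++ Semicolon :: w) ++ blanks d)
      (blanks a, ones j ++ blanks b.+1) o) =
  cfg Source (l', marks w ++ blanks d') (blanks a', ones j.+1 ++ blanks b.+1)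
    (catrev (marks (nseq u One ++ Comma :: nseq j One ++ Semicolon ::
                    nseq v One ++ Comma :: nseq j One ++ [:: Semicolon])) o).
Proof.
(* The lemmas on single phases expect the scanned cell to be listed; on a nonempty list [head] and
   [behead] exhibit it. *)
have counterE : ones j ++ blanks b.+1 =
    head None (ones j ++ blanks b.+1) :: behead (ones j ++ blanks b.+1).
  by case: j.
(* After the last edge the input head is on a blank, which becomes listed when it is rewritten. *)
have [d' inputE] : exists d', head None (marks w ++ blanks d) ::
    behead (marks w ++ blanks d) = marks w ++ blanks d'.
  case: w => [|x w]; last by exists d.
  by case: d => [|d]; [exists 1|exists d.+1].
have -> : marks (nseq u One ++ Comma :: nseq v One ++ Semicolon :: w) ++ blanks d =
    ones u ++ mark Comma :: ones v ++ mark Semicolon :: marks w ++ blanks d.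
  by rewrite !(map_cat, map_cons, map_nseq) -!catA /= -!catA.
do 3!eexists.
apply: run_trans; first by rewrite counterE; apply: run_source.
rewrite -counterE; have -> : ones v ++ mark Semicolon :: marks w ++ blanks d =
    head None (ones v ++ mark Semicolon :: marks w ++ blanks d) ::
    behead (ones v ++ mark Semicolon :: marks w ++ blanks d) by case: (v).
apply: run_trans; first exact: run_counter_right.
have <- : ones v ++ mark Semicolon :: marks w ++ blanks d =
    head None (ones v ++ mark Semicolon :: marks w ++ blanks d) ::
    behead (ones v ++ mark Semicolon :: marks w ++ blanks d) by case: (v).
apply: run_trans; first exact: run_target.
rewrite (catrev_ones j (blanks a)); apply: etrans; first exact: run_counter_left.
rewrite inputE /=; congr cfg; first by rewrite catrev_ones.
by rewrite !map_cat /= !map_cat !map_nseq /= !map_cat !map_nseq /= !map_cat !map_nseq /=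
  catrev_catl /= catrev_catl /= catrev_catl /= catrev_catl.
Qed.

(** An edge costs the length of its encoding plus two passes over the counter, each of at most
    [j + size s] steps since the counter stays below that value until the last edge is done. *)
Lemma run_edges n (s : seq ('I_n * 'I_n)) j l a b d o : exists m l' a' d',
  (m <= size (enc_edges s) + size s * (2 * (j + size s)))%N /\
  run m (cfg Source (l, marks (enc_edges s) ++ blanks d)
          (blanks a, ones j ++ blanks b.+1) o) =
  cfg Source (l', blanks d') (blanks a', ones (j + size s) ++ blanks b.+1)
    (catrev (marks (enc_half_edges s j)) o).
Proof.
elim: s j l a d o => [|e s IHs] j l a d o.
  by exists 0, l, a, d; split; rewrite //= ?addn0.
rewrite enc_edges_cons.
have [l1 [a1 [d1 run_e]]] := run_edge e.1 e.2 j (enc_edges s) l a b d o.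
have [m [l2 [a2 [d2 [m_le run_s]]]]] := IHs j.+1 l1 a1 d1
  (catrev (marks (nseq e.1 One ++ Comma :: nseq j One ++ Semicolon ::
                    nseq e.2 One ++ Comma :: nseq j One ++ [:: Semicolon])) o).
exists (e.1.+1 + (j.+1 + (e.2.+1 + j.+1)) + m), l2, a2, d2; split.
  by rewrite !(size_cat, size_nseq) /= size_cat size_nseq /=; nia.
rewrite (run_trans run_e run_s) -catrev_catl -map_cat addSnnS.
by rewrite /enc_half_edges /=.
Qed.

Lemma tape_holds_output w b :
  tape_holds (map inl w) (catrev (marks w) [::], blanks b).
Proof. by exists 0, b; rewrite /= !catrevE cats0 revK -map_comp. Qed.

Lemma subdivider_computes n (s : seq ('I_n * 'I_n)) w : Bar \notin w ->
  exists2 m, (m <= 4 * size (w ++ Bar :: enc_edges s) ^ 2 + 4)%N &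
    tm_computes_in subdivider m (w ++ Bar :: enc_edges s)
      (w ++ Bar :: enc_edges (half_edges s) ++ Bar :: nseq (size s) One).
Proof.
move=> Bar_w.
(* Every edge contributes symbols to the input, so the counter is bounded by the input length and
   the total time is quadratic. *)
have s_le : (size s <= size (enc_edges s))%N.
  by elim: s => // e s IHs; rewrite enc_edges_cons !size_cat /= size_cat /=; lia.
(* The counter tape left by [run_points] is a counter of value 0 followed by one listed blank. *)
have [m [l [a [d [m_le run_s]]]]] := run_edges s 0
  (catrev (marks (rcons w Bar)) [::]) 0 0 0 (catrev (marks (rcons w Bar)) [::]).
have run_w := run_points [::] (marks (enc_edges s)) ([::], [::]) [::] Bar_w.
have run_end := run_mobile (size s) _ _ _ 1.
have [c [i run_m]] := run_end l (head None (blanks d) :: behead (blanks d)) (blanks a)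
  (mark Bar :: catrev (marks (enc_half_edges s 0)) (catrev (marks (rcons w Bar)) [::])).
(* The points with their [Bar], the edges, one step to enter [Mobile], and [(size s).+1] steps to
   copy the counter and halt. *)
exists (((size w).+1 + m) + (size s).+2).
  by rewrite size_cat /=; nia.
rewrite /tm_computes_in.
have -> : tm_init subdivider (w ++ Bar :: enc_edges s) =
    cfg Points ([::], marks w ++ mark Bar :: marks (enc_edges s)) ([::], [::]) [::].
  by apply: config_eq; rewrite //= /word_tape -map_comp map_cat.
rewrite cats0 in run_s.
rewrite (run_trans (run_trans run_w run_s) (run_step _ run_m)); last first.
  by case: d {run_s run_m} => [|d]; case: (size s) => [|j]; apply: config_eq.
split=> //; rewrite [tnth _ _]/= enc_edges_half_edges.
have -> : [:: None] = blanks 1 by [].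
set out := catrev _ _; have -> : out = catrev (marks (w ++ Bar ::
    enc_half_edges s 0 ++ Bar :: nseq (size s) One)) [::].
  by rewrite /out -(cat_rcons Bar w) !map_cat !catrev_catl map_cons map_nseq.
exact: tape_holds_output.
Qed.

(** * Concatenation, reversal and refinement of poly-lines *)

Section Polylines.
Local Open Scope ring_scope.
Variable R : realType.
Implicit Types (a b m : R * R) (p q r : seq (R * R)).

Lemma polyline_point0 q i : polyline_point q i 0 = nth (0, 0) q i.
Proof. by rewrite /polyline_point !mul0r !addr0 -surjective_pairing. Qed.

Lemma polyline_point1 q i : polyline_point q i 1 = nth (0, 0) q i.+1.
Proof. by rewrite /polyline_point !mul1r !subrKC -surjective_pairing. Qed.

Lemma polyline_point_catl p m r i t : (i < size p)%N ->
  polyline_point (p ++ m :: r) i t = polyline_point (rcons p m) i t.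
Proof.
by move=> i_p; rewrite /polyline_point -cat_rcons !nth_cat size_rcons !ltnS i_p ltnW.
Qed.

Lemma polyline_point_catr p m r i t :
  polyline_point (p ++ m :: r) (size p + i) t = polyline_point (m :: r) i t.
Proof.
by rewrite /polyline_point -addnS !nth_cat !ltnNge !leq_addr /= !addKn.
Qed.

(** Reversal sends the traversal parameter [x] to [size q - 1 - x]. *)
Lemma polyline_point_rev q i t : (i.+1 < size q)%N ->
  polyline_point (rev q) i t = polyline_point q (size q - i.+2) (1 - t).
Proof.
move=> i_q; rewrite /polyline_point !nth_rev ?(ltnW i_q)// -subSn// subSS.
by congr (_, _); ring.
Qed.

Lemma polyline_cat p m r :
  polyline (p ++ m :: r) = (polyline (rcons p m) `|` polyline (m :: r))%classic.
Proof.
apply/seteqP; split=> x.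
- case=> i [t []]; rewrite size_cat /= => i_lt t01 ->.
  have [i_p|p_i] := ltnP i (size p).
    by left; exists i, t; rewrite size_rcons ltnS polyline_point_catl.
  right; exists (i - size p)%N, t; split=> //=; first lia.
  by rewrite -{1}(subnKC p_i) polyline_point_catr.
- case=> -[i [t []]].
    rewrite size_rcons => i_p t01 ->; exists i, t.
    by split=> //; [rewrite size_cat /=; lia|rewrite polyline_point_catl].
  move=> /= i_r t01 ->; exists (size p + i)%N, t.
  by split=> //; [rewrite size_cat /=; lia|rewrite polyline_point_catr].
Qed.

Lemma polyline_head a b q : polyline (a :: rcons q b) a.
Proof.
exists 0%N, 0; rewrite /= size_rcons polyline_point0; split=> //.
by rewrite lexx ler01.
Qed.

Lemma polyline_last a b q : polyline (a :: rcons q b) b.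
Proof.
exists (size q), 1; rewrite /= size_rcons polyline_point1; split=> //.
  by rewrite lexx ler01.
by rewrite /= nth_rcons ltnn eqxx.
Qed.

(** The ends have the distinct traversal parameters 0 and [size q + 1]. *)
Lemma simple_polyline_neq a b q : simple_polyline (a :: rcons q b) -> a <> b.
Proof.
move=> simple_q ab.
have := simple_q 0%N (size q) 0 1.
rewrite /= size_rcons polyline_point0 polyline_point1 /= nth_rcons ltnn eqxx.
rewrite !lexx !ler01 addr0 => /(_ isT (ltnSn _) isT isT ab) /eqP.
by rewrite -mulrSr eq_sym pnatr_eq0.
Qed.

Lemma polyline_rev q : polyline (rev q) = polyline q.
Proof.
have sub q' : (polyline (rev q') `<=` polyline q')%classic.
  move=> x [i [t []]]; rewrite size_rev => i_q t01 ->.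
  exists (size q' - i.+2)%N, (1 - t); rewrite polyline_point_rev//.
  split=> //; [lia|lra].
by apply/seteqP; split=> //; rewrite -{1}(revK q).
Qed.

Lemma simple_polyline_rev q : simple_polyline q -> simple_polyline (rev q).
Proof.
move=> simple_q i j s t; rewrite size_rev => i_q j_q s01 t01.
rewrite !polyline_point_rev// => /simple_q h.
have {h} : (size q - i.+2)%:R + (1 - s) = (size q - j.+2)%:R + (1 - t).
  by apply: h; first [lia|lra].
rewrite !natrB// -[i.+2]addn2 -[j.+2]addn2 !natrD; lra.
Qed.

Lemma simple_polyline_catl p m r :
  simple_polyline (p ++ m :: r) -> simple_polyline (rcons p m).
Proof.
move=> simple_q i j s t; rewrite size_rcons !ltnS => i_p j_p s01 t01 e.
by apply: simple_q; rewrite ?size_cat /= ?polyline_point_catl//; lia.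
Qed.

Lemma simple_polyline_catr p m r :
  simple_polyline (p ++ m :: r) -> simple_polyline (m :: r).
Proof.
move=> simple_q i j s t /= i_r j_r s01 t01 e.
have := simple_q (size p + i)%N (size p + j)%N s t.
rewrite size_cat /= !polyline_point_catr !natrD -!addrA => /(_ _ _ s01 t01 e) h.
by apply: (addrI (size p)%:R); apply: h; lia.
Qed.

(** A common point has a parameter at most [size p] on the first part and at least [size p] on the
    second. By simplicity both equal [size p], which is the parameter of [m]. *)
Lemma simple_polyline_catI p m r : simple_polyline (p ++ m :: r) ->
  (polyline (rcons p m) `&` polyline (m :: r) `<=` [set m])%classic.
Proof.
move=> simple_q x [[i [s []]]].
rewrite size_rcons ltnS => i_p s01 -> [j [t [/= j_r t01 e]]].
have := simple_q i (size p + j)%N s t; rewrite size_cat /= polyline_point_catl//.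
rewrite polyline_point_catr natrD => /(_ _ _ s01 t01 e) ist.
have {}ist : i%:R + s = (size p)%:R + j%:R + t by apply: ist; lia.
have j_ge0 : 0 <= j%:R :> R by [].
have p_ge : i%:R + 1 <= (size p)%:R :> R by rewrite -mulrSr ler_nat.
have s1 : s = 1 by lra.
have ip : i.+1 = size p.
  by apply/eqP; rewrite -(eqr_nat R) mulrSr; apply/eqP; lra.
by rewrite s1 polyline_point1 /= nth_rcons ip ltnn eqxx.
Qed.

Lemma simple_polyline_cat a m b p r :
  simple_polyline (a :: rcons p m) -> simple_polyline (m :: rcons r b) ->
  (polyline (a :: rcons p m) `&` polyline (m :: rcons r b) `<=` [set m])%classic ->
  simple_polyline ((a :: p) ++ m :: rcons r b).
Proof.
set q1 := a :: rcons p m; set q2 := m :: rcons r b => simple1 simple2 q12.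
have sz1 : size q1 = (size p).+2 by rewrite /= size_rcons.
(* A point on both parts is [m], which has parameter [(size p).+1] on [q1] and 0 on [q2], by
   simplicity of each. *)
have mixed i j s t : (i < (size p).+1)%N -> (j.+1 < size q2)%N ->
    0 <= s <= 1 -> 0 <= t <= 1 -> polyline_point q1 i s = polyline_point q2 j t ->
    i%:R + s = (size p).+1%:R + j%:R + t.
  move=> i_p j_r s01 t01 e.
  have xm : polyline_point q1 i s = m.
    by apply: q12; split; [exists i, s; rewrite sz1|rewrite e; exists j, t].
  have /simple1 : polyline_point q1 i s = polyline_point q1 (size p) 1.
    by rewrite xm polyline_point1 /= nth_rcons ltnn eqxx.
  rewrite sz1 => -> //; last by rewrite ler01 lexx.
  have /simple2 : polyline_point q2 j t = polyline_point q2 0 0.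
    by rewrite -e xm polyline_point0.
  move=> /(_ j_r) jt.
  have -> : (size p).+1%:R + j%:R + t = (size p).+1%:R + (j%:R + t) by rewrite addrA.
  have -> : j%:R + t = 0.
    by rewrite jt ?addr0 //= ?size_rcons// lexx ler01.
  by rewrite addr0 -mulrSr.
have sz2 : size q2 = (size r).+2 by rewrite /= size_rcons.
have szp : size (a :: p) = (size p).+1 by [].
move=> i j s t; rewrite size_cat -/q2 => i_q j_q s01 t01.
have [i_p|p_i] := ltnP i (size (a :: p)); have [j_p|p_j] := ltnP j (size (a :: p)).
- rewrite !polyline_point_catl//; apply: simple1 => //; rewrite ?sz1//.
- rewrite -(subnKC p_j) polyline_point_catl// polyline_point_catr natrD.
  by apply: mixed => //; lia.
- rewrite -(subnKC p_i) [in RHS]polyline_point_catl// polyline_point_catr natrD.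
  by move=> /esym e; apply/esym; apply: mixed e => //; lia.
- rewrite -(subnKC p_i) -(subnKC p_j) !polyline_point_catr !natrD -!addrA.
  by move=> /simple2 -> //; lia.
Qed.

(** The refined line at parameter [x] is the segment at [x / 2]. This gives a straight edge a corner
    at which a mobile vertex can be put. *)
Lemma polyline_midpoint a b : simple_polyline [:: a; b] ->
  let m := ((a.1 + b.1) / 2, (a.2 + b.2) / 2) in
  simple_polyline [:: a; m; b] /\ polyline [:: a; m; b] = polyline [:: a; b].
Proof.
move=> simple_ab m.
have pointE i t : (i < 2)%N -> polyline_point [:: a; m; b] i t =
    polyline_point [:: a; b] 0 ((i%:R + t) / 2).
  by case: i => [|[|//]] _; rewrite /polyline_point /=; congr (_, _); field.
split.
  move=> i j s t /= i2 j2 s01 t01; rewrite !pointE// => /simple_ab.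
  have i1 : i%:R <= 1 :> R by rewrite lern1; lia.
  have j1 : j%:R <= 1 :> R by rewrite lern1; lia.
  have i0 : 0 <= i%:R :> R by [].
  have j0 : 0 <= j%:R :> R by [].
  move=> h; suff : 0%:R + (i%:R + s) / 2 = 0%:R + (j%:R + t) / 2 :> R by lra.
  by apply: h => //; lra.
apply/seteqP; split=> x.
  move=> [i [t [/= i2 t01 ->]]]; rewrite pointE//.
  have i1 : i%:R <= 1 :> R by rewrite lern1; lia.
  have i0 : 0 <= i%:R :> R by [].
  by exists 0%N, ((i%:R + t) / 2); split=> //; lra.
move=> [[|i] [t [// _ t01 ->]]].
have [t_le|t_gt] := lerP t (1 / 2).
  exists 0%N, (2 * t); split=> //; first by lra.
  by rewrite pointE//; congr polyline_point; lra.
exists 1%N, (2 * t - 1); split=> //; first by lra.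
by rewrite pointE//; congr polyline_point; lra.
Qed.

End Polylines.

(** * Sub-arcs and reversal of arcs *)

Section Arcs.
Local Open Scope ring_scope.
Variable R : realType.
Implicit Types (a b m : R * R) (T : set (R * R)).

Lemma affine_continuous (c e : R) : continuous (fun t : R => c + t * e).
Proof.
move=> x; apply: cvgD; first exact: cvg_cst.
apply: cvgM; first exact: cvg_id.
exact: cvg_cst.
Qed.

Notation unit_interval := [set t : R | 0 <= t <= 1]%classic.

(** Reparametrize affinely from [c] to [d]. As [d] may be smaller than [c], reversal is the case of
    1 and 0. *)
Lemma is_arc_sub (gamma : R -> R * R) (c d : R) :
  {within unit_interval, continuous gamma}%classic ->
  {in [pred t | 0 <= t <= 1] &, injective gamma} ->
  0 <= c <= 1 -> 0 <= d <= 1 -> c != d ->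
  is_arc (gamma c) (gamma d)
    [set gamma (c + t * (d - c)) | t in unit_interval]%classic.
Proof.
move=> gamma_cont gamma_inj c01 d01 cd.
have sub t : 0 <= t <= 1 -> 0 <= c + t * (d - c) <= 1 by move=> t01; nra.
exists (fun t => gamma (c + t * (d - c))); split=> //.
- apply/subspace_continuousP => x x01.
  have /subspace_continuousP/(_ _ (sub x x01)) := gamma_cont.
  apply: cvg_comp => W /= W_near.
  have : nbhs x (fun t => 0 <= c + t * (d - c) <= 1 -> W (c + t * (d - c))).
    exact: affine_continuous W_near.
  (* Unfolding continuity within the interval leaves a condition on parameters in [[0, 1]] only,
     which [sub] transfers through the affine map. *)
  change (nbhs x (fun t => 0 <= c + t * (d - c) <= 1 -> W (c + t * (d - c))) ->
    nbhs x (fun t => 0 <= t <= 1 -> W (c + t * (d - c)))).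
  by apply: filterS => t Wt t01; exact: Wt (sub t t01).
- move=> s t s01 t01 /gamma_inj; rewrite !inE => /(_ (sub s s01) (sub t t01)).
  by move=> /addrI/mulIf; apply; rewrite subr_eq0 eq_sym.
- by rewrite mul0r addr0.
- by rewrite mul1r subrKC.
Qed.

Lemma is_arc_sym a b T : is_arc a b T -> is_arc b a T.
Proof.
case=> gamma [gamma_cont gamma_inj <- <- ->].
have -> : ([set gamma t | t in unit_interval] =
    [set gamma (1 + t * (0 - 1)) | t in unit_interval])%classic.
  by apply/seteqP; split=> _ [t /= t01 <-]; (exists (1 - t) => /=; [lra|congr gamma; lra]).
by apply: is_arc_sub; rewrite ?lexx ?ler01 ?oner_eq0.
Qed.

Lemma is_arc_ends a b T : is_arc a b T -> T a /\ T b.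
Proof.
by case=> gamma [_ _ <- <- ->]; split; [exists 0|exists 1]; rewrite /= ?lexx ?ler01.
Qed.

End Arcs.

(** * Splitting and joining edges *)

Section Subdivision.
Local Open Scope ring_scope.
Variable R : realType.
Implicit Types (a b m : R * R) (T : set (R * R)).

(** The curve class [D] is a parameter so that one subdivision argument serves both arcs and
    poly-lines. The point [m] is to carry a new vertex, so it must avoid both ends. *)
Definition splits (D : R * R -> R * R -> set (R * R) -> Prop) a b T : Prop :=
  exists m (A B : set (R * R)),
    [/\ T = (A `|` B)%classic, (A `&` B `<=` [set m])%classic, m <> a /\ m <> b,
        D a m A & D m b B].

Lemma is_arc_splits a b T : is_arc a b T -> splits (@is_arc R) a b T.
Proof.
case=> gamma [gamma_cont gamma_inj <- <- ->].
have half01 : 0 <= (1 / 2 : R) <= 1 by lra.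
have inj s t : 0 <= s <= 1 -> 0 <= t <= 1 -> gamma s = gamma t -> s = t.
  by move=> s01 t01; apply: gamma_inj.
exists (gamma (1 / 2)).
exists [set gamma (0 + t * (1 / 2 - 0)) | t in [set t : R | 0 <= t <= 1]]%classic.
exists [set gamma (1 / 2 + t * (1 - 1 / 2)) | t in [set t : R | 0 <= t <= 1]]%classic.
split.
- apply/seteqP; split=> [_ [t /= t01 <-]|x].
    have [t_le|t_gt] := lerP t (1 / 2); [left; exists (2 * t)|right; exists (2 * t - 1)];
      first [by congr gamma; lra|by rewrite /=; lra].
  case=> -[t /= t01 <-]; [exists (0 + t * (1 / 2 - 0))|exists (1 / 2 + t * (1 - 1 / 2))] => //.
    by rewrite /=; lra.
  by rewrite /=; lra.
- move=> x [[s /= s01 <-] [t /= t01 /inj]] => e.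
  by congr gamma; have {e} := e _ _; lra.
- by split=> /inj e; have {e} := e _ _; lra.
- by apply: is_arc_sub => //; lra.
- by apply: is_arc_sub => //; lra.
Qed.

Lemma is_polyline_ends k a b T : is_polyline k a b T -> T a /\ T b.
Proof.
by case=> q [_ _ ->]; split; [exact: polyline_head|exact: polyline_last].
Qed.

Lemma is_polyline_sym k a b T : is_polyline k a b T -> is_polyline k b a T.
Proof.
case=> q [q_k simple_q ->]; exists (rev q); rewrite size_rev.
have -> : b :: rcons (rev q) a = rev (a :: rcons q b) by rewrite rev_cons rev_rcons.
by split=> //; [exact: simple_polyline_rev|rewrite polyline_rev].
Qed.

Lemma is_polyline_splits k a b T :
  is_polyline (2 * k + 1) a b T -> splits (is_polyline k) a b T.
Proof.
case=> q0 [q0_k simple_q0 ->].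
(* A line without bends receives its midpoint as a bend, which the bound [2 * k + 1] allows even for
   [k = 0]. *)
have [q [q_gt0 q_k simple_q ->]] : exists q, [/\ (0 < size q)%N,
    (size q <= 2 * k + 1)%N, simple_polyline (a :: rcons q b) &
    polyline (a :: rcons q0 b) = polyline (a :: rcons q b)].
  case: q0 q0_k simple_q0 => [|m q] q_k simple_q; last by exists (m :: q).
  have [simple_m <-] := polyline_midpoint simple_q.
  by exists [:: ((a.1 + b.1) / 2, (a.2 + b.2) / 2)]; split=> //; rewrite addn1.
(* With at most [2 * k + 1] bends, at most [k] precede the one of index [(size q)./2] and at most
   [k] follow it. *)
pose p := take (size q)./2 q; pose r := drop (size q)./2.+1 q.
pose m := nth a q (size q)./2.
have q_half : ((size q)./2 < size q)%N by lia.
have qE : q = p ++ m :: r.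
  by rewrite -(drop_nth a q_half) cat_take_drop.
have p_k : (size p <= k)%N by rewrite size_take q_half; lia.
have r_k : (size r <= k)%N by rewrite size_drop; lia.
have {}qE : a :: rcons q b = (a :: p) ++ m :: rcons r b by rewrite qE rcons_cat.
rewrite {}qE in simple_q *.
have simple_p := simple_polyline_catl simple_q.
have simple_r := simple_polyline_catr simple_q.
exists m, (polyline (a :: rcons p m)), (polyline (m :: rcons r b)).
rewrite polyline_cat; split=> //.
- exact: simple_polyline_catI simple_q.
- split; last exact: simple_polyline_neq simple_r.
  exact/nesym/(simple_polyline_neq simple_p).
- by exists p.
- by exists r.
Qed.

Lemma is_polyline_join k a m b A B :
  is_polyline k a m A -> is_polyline k m b B -> (A `&` B `<=` [set m])%classic ->
  is_polyline (2 * k + 1) a b (A `|` B)%classic.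
Proof.
case=> p [p_k simple_p ->] [r [r_k simple_r ->]] AB.
exists (p ++ m :: r); rewrite size_cat rcons_cat /= -cat_cons; split; first lia.
  exact: simple_polyline_cat.
by rewrite polyline_cat.
Qed.

End Subdivision.

(** * Drawings of a graph and of its subdivision *)

Section SubdividedGraph.
Local Open Scope ring_scope.
Variables (R : realType) (n : nat) (s : seq ('I_n * 'I_n)).
Hypotheses (uniq_s : uniq s) (lt_s : lt_pairs s).

Notation G := (list_graph lt_s).
Notation H := (bigraph_graph (list_bigraph (half_edges s))).
Notation src j := (tnth (in_tuple s) j).1.
Notation tgt j := (tnth (in_tuple s) j).2.

Lemma src_neq_tgt j : src j != tgt j.
Proof.
have /allP/(_ _ (mem_tnth j (in_tuple s))) := lt_s.
by move=> /= /ltn_eqF; rewrite -val_eqE => ->.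
Qed.

Lemma list_adj_ends j : adj (src j : G) (tgt j).
Proof. by rewrite /= /list_adj -surjective_pairing mem_tnth. Qed.

Lemma list_adjP (u v : G) : adj u v ->
  exists j, (u, v) = (src j, tgt j) \/ (u, v) = (tgt j, src j).
Proof.
case/orP=> /(tnthP (in_tuple s))[j e]; exists j; [left|right]; rewrite -e//.
Qed.

(** Each edge is listed with its smaller end first, so the unordered pair of ends determines the
    entry, and the list has no duplicates. *)
Lemma ends_inj i j :
  [set src i; tgt i]%SET = [set src j; tgt j]%SET -> i = j.
Proof.
move=> e; apply/(tuple_uniqP (in_tuple s) uniq_s).
have lt i' : (src i' < tgt i')%N.
  by have /allP/(_ _ (mem_tnth i' (in_tuple s))) := lt_s.
have : src i \in [set src j; tgt j]%SET by rewrite -e !inE eqxx.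
have : tgt i \in [set src j; tgt j]%SET by rewrite -e !inE eqxx orbT.
have := lt i; have := lt j; rewrite !inE => ltj lti /orP[] /eqP ti /orP[] /eqP si.
- by move: lti; rewrite ti si ltnn.
- by move: lti; rewrite ti si ltnNge ltnW.
- by rewrite [LHS]surjective_pairing si ti -surjective_pairing.
- by move: lti; rewrite ti si ltnn.
Qed.

Definition half_adj (u : 'I_n) j := (u == src j) || (u == tgt j).

Lemma half_adj_adj (u : 'I_n) j : adj (inl u : H) (inr j) = half_adj u j.
Proof. by rewrite /= mem_half_edges. Qed.

Lemma bigraph_adjP (x y : H) : adj x y -> exists u j,
  half_adj u j /\ ((x, y) = (inl u, inr j) \/ (x, y) = (inr j, inl u)).
Proof.
case: x y => [u|j] [v|i] //=; rewrite mem_half_edges => adj_u.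
  by exists u, i; split=> //; left.
by exists v, j; split=> //; right.
Qed.

(** [D] and [D'] are [is_arc] twice for the planarity of the subdivision, and
    poly-lines with [2 * k + 1] and [k] bends for the reduction. *)
Section Subdivide.
Variables (D D' : R * R -> R * R -> set (R * R) -> Prop).
Hypotheses (D_splits : forall a b T, D a b T -> splits D' a b T)
  (D'_sym : forall a b T, D' a b T -> D' b a T)
  (D'_ends : forall a b T, D' a b T -> T a /\ T b).

(** Mobile vertices go to the splitting points. Halves of one edge meet only there; halves of
    different edges can meet only at a vertex of the old drawing, and a half contains no such vertex
    except its own fixed end. *)
Lemma subdivide_drawing (pos : G -> R * R) (trace : G -> G -> set (R * R)) :
  crossing_free pos trace ->
  (forall u v, adj u v -> D (pos u) (pos v) (trace u v)) ->
  exists (pos' : H -> R * R) (trace' : H -> H -> set (R * R)),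
    [/\ forall u, pos' (inl u) = pos u, crossing_free pos' trace' &
        forall x y, adj x y -> D' (pos' x) (pos' y) (trace' x y)].
Proof.
move=> [pos_inj _ cfv cfe] drawn.
have /choice[mid /choice[A /choice[B AB]]] :
    forall j, exists m A B, [/\ trace (src j) (tgt j) = (A `|` B)%classic,
      (A `&` B `<=` [set m])%classic, m <> pos (src j) /\ m <> pos (tgt j),
      D' (pos (src j)) m A & D' m (pos (tgt j)) B].
  by move=> j; apply: D_splits; apply: drawn; apply: list_adj_ends.
pose half (u : 'I_n) j := if u == src j then A j else B j.
have half_tgt j : half (tgt j) j = B j.
  by rewrite /half eq_sym (negbTE (src_neq_tgt j)).
have half_src j : half (src j) j = A j by rewrite /half eqxx.
have half_drawn u j : half_adj u j -> D' (pos u) (mid j) (half u j).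
  have [_ _ _ DA DB] := AB j.
  by case/orP=> /eqP->; rewrite ?half_tgt ?half_src//; apply: D'_sym.
have half_sub u j : (half u j `<=` trace (src j) (tgt j))%classic.
  by have [-> _ _ _ _] := AB j; rewrite /half; case: eqP => _ p; [left|right].
have half_meet u v j p : half_adj u j -> half_adj v j -> u != v ->
    half u j p -> half v j p -> p = mid j.
  have [_ ABm _ _ _] := AB j.
  case/orP=> /eqP-> /orP[] /eqP->; rewrite ?eqxx// ?half_tgt ?half_src => _.
    by move=> Ap Bp; apply: ABm.
  by move=> Bp Ap; apply: ABm.
(* Another vertex on the half would be the other end of the edge, hence on both halves, hence the
   splitting point, which is not an end. *)
have half_pos u v j : half_adj u j -> half u j (pos v) -> v = u.
  move=> adj_uj uj_v; apply/eqP/negPn/negP => vu.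
  have adj_vj : half_adj v j.
    have := cfv _ _ _ (list_adj_ends j) (half_sub _ _ _ uj_v).
    by rewrite /half_adj => -[] ->; rewrite eqxx ?orbT.
  have [vj _] := D'_ends (half_drawn _ _ adj_vj).
  have := half_meet _ _ _ _ adj_vj adj_uj vu vj uj_v.
  have [_ _ [/nesym m1 /nesym m2] _ _] := AB j.
  by case/orP: adj_vj => /eqP->.
have mid_edge j : trace (src j) (tgt j) (mid j).
  by apply: (half_sub (src j)); apply: (D'_ends (half_drawn _ _ _)).2; rewrite /half_adj eqxx.
have mid_pos j v : mid j <> pos v.
  move=> mv; have [_ _ [m1 m2] _ _] := AB j.
  have := mid_edge j; rewrite mv => /(cfv _ _ _ (list_adj_ends j)).
  by case=> e; rewrite e in mv.
have edge_meet i j p : i != j -> trace (src i) (tgt i) p -> trace (src j) (tgt j) p ->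
    exists w, p = pos w.
  move=> ij ip jp; have [|w _ ->] := cfe _ _ _ _ p (list_adj_ends i) (list_adj_ends j) _ ip jp.
    by apply: contra ij => /eqP/ends_inj->.
  by exists w.
(* A splitting point on a second edge would be a common point of two edges, thus a vertex, against
   [mid_pos]. *)
have mid_on i j : trace (src j) (tgt j) (mid i) -> i = j.
  move=> on_j; apply/eqP/negPn/negP => ij.
  by have [w /mid_pos] := edge_meet _ _ _ ij (mid_edge i) on_j.
pose pos' (x : H) := match x with inl u => pos u | inr j => mid j end.
pose trace' (x y : H) : set (R * R) :=
  match x, y with inl u, inr j => half u j | inr j, inl u => half u j | _, _ => set0 end.
exists pos', trace'; split=> //; last first.
  move=> x y /bigraph_adjP[u [j [adj_uj]]] [] [-> ->] /=; first exact: half_drawn.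
  exact/D'_sym/half_drawn.
(* This reduces both orientations of an edge to the one from its fixed to its mobile end. *)
have adjP x y : adj x y -> exists u j,
    [/\ half_adj u j, trace' x y = half u j,
        [set x; y]%SET = [set inl u; inr j : H]%SET &
        forall z, z = inl u \/ z = inr j -> z = x \/ z = y].
  case/bigraph_adjP=> u [j [adj_uj]] [] [-> ->]; exists u, j; split=> //.
    by rewrite finset.setUC.
  by move=> z [->|->]; [right|left].
split.
- move=> [u|i] [v|j] /=; first by move/pos_inj->.
  + by move/esym/mid_pos.
  + by move/mid_pos.
  + by move=> e; congr inr; apply: mid_on; rewrite e; apply: mid_edge.
- by case=> [u|i] [v|j].
- move=> x y z /adjP[u [j [adj_uj -> _ zP]]] on_z; apply: zP; case: z on_z => [v|i] /=.
    by move/(half_pos _ _ _ adj_uj)->; left.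
  by move/half_sub/mid_on->; right.
- move=> x y z t p /adjP[u [j [adj_uj -> -> _]]] /adjP[v [i [adj_vi -> -> _]]] neq.
  move=> pu pv; have [ij|ij] := eqVneq j i.
    subst i; have uv : u != v by apply: contra neq => /eqP->.
    by exists (inr j); [rewrite !inE !eqxx !orbT|exact: half_meet pu pv].
  have [w pw] := edge_meet _ _ _ ij (half_sub _ _ _ pu) (half_sub _ _ _ pv).
  rewrite pw in pu pv; exists (inl w) => //.
  by rewrite -(half_pos _ _ _ adj_uj pu) -(half_pos _ _ _ adj_vi pv) !inE eqxx.
Qed.

End Subdivide.

Lemma merge_drawing k (pos' : H -> R * R) (trace' : H -> H -> set (R * R)) :
  polyline_drawing k pos' trace' ->
  exists trace : G -> G -> set (R * R),
    polyline_drawing (G := G) (2 * k + 1) (fun u : 'I_n => pos' (inl u)) trace.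
Proof.
move=> [[pos_inj cfs cfv cfe] drawn].
pose edge j := (trace' (inl (src j)) (inr j) `|` trace' (inl (tgt j)) (inr j))%classic.
(* Selecting the edge by its unordered pair of ends makes the trace symmetric; by [ends_inj] the
   index [j] is unique. *)
pose trace (u v : G) : set (R * R) :=
  [set p | exists2 j, [set u; v]%SET = [set src j; tgt j]%SET & edge j p]%classic.
have traceE u v j : [set u; v]%SET = [set src j; tgt j]%SET -> trace u v = edge j.
  move=> uv; apply/seteqP; split=> p; last by exists j.
  by case=> i; rewrite uv => /ends_inj->.
have half_edge j p : edge j p ->
    exists u, half_adj u j /\ trace' (inl u) (inr j) p.
  by case=> ?; [exists (src j)|exists (tgt j)]; rewrite /half_adj eqxx ?orbT.
have adjP (u v : G) : adj u v -> exists j, [set u; v]%SET = [set src j; tgt j]%SET.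
  by case/list_adjP=> j [] [-> ->]; exists j; rewrite // finset.setUC.
have half_pos u j w : half_adj u j -> trace' (inl u) (inr j) (pos' (inl w)) -> w = u.
  rewrite -half_adj_adj => adj_uj /(cfv _ _ _ adj_uj).
  by case=> // -[].
exists trace; split.
  split.
  - by move=> u v /pos_inj[].
  - by move=> u v _; rewrite /trace finset.setUC.
  - move=> u v w /adjP[j uv]; rewrite (traceE _ _ _ uv) => /half_edge[x [adj_xj]].
    move=> /(half_pos _ _ _ adj_xj)->.
    have : x \in [set u; v]%SET by rewrite uv !inE.
    by rewrite !inE => /orP[] /eqP->; [left|right].
  - move=> u v x y p /adjP[j uv] /adjP[i xy] neq.
    rewrite (traceE _ _ _ uv) (traceE _ _ _ xy).
    move=> /half_edge[z [adj_zj zj]] /half_edge[t [adj_ti ti]].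
    have ij : j != i by apply: contra neq; rewrite uv xy => /eqP->.
    (* The shared vertex is fixed, as the mobile vertices [j] and [i] differ; it is then a common
       end of both edges of [G]. *)
    have [| | |w] := cfe (inl z) (inr j) (inl t) (inr i) p _ _ _ zj ti.
    + by rewrite half_adj_adj.
    + by rewrite half_adj_adj.
    + apply: contra ij => /eqP/setP/(_ (inr j)).
      by rewrite !inE eqxx orbT => /esym/orP[] /eqP// [->].
    rewrite !inE => /andP[/orP[]/eqP-> /orP[]/eqP//].
      move=> [zt] pz; exists z => //; rewrite inE uv xy; rewrite -zt in adj_ti.
      by rewrite !inE; apply/andP.
    by move=> [e]; rewrite e eqxx in ij.
have join j : is_polyline (2 * k + 1) (pos' (inl (src j))) (pos' (inl (tgt j))) (edge j).
  have adj_src : adj (inl (src j) : H) (inr j) by rewrite half_adj_adj /half_adj eqxx.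
  have adj_tgt : adj (inl (tgt j) : H) (inr j) by rewrite half_adj_adj /half_adj eqxx orbT.
  apply: (is_polyline_join (drawn _ _ adj_src)).
    exact/is_polyline_sym/drawn.
  (* The two halves have different fixed ends, so the mobile vertex is the only vertex that they
     share. *)
  move=> p [pA pB]; have [|w] := cfe _ _ _ _ _ adj_src adj_tgt _ pA pB.
    apply: contra (src_neq_tgt j) => /eqP/setP/(_ (inl (src j))).
    by rewrite !inE eqxx => /esym/orP[] /eqP// [->].
  rewrite !inE => /andP[/orP[]/eqP-> /orP[]/eqP//].
  by move=> [e]; have := src_neq_tgt j; rewrite e eqxx.
move=> u v /list_adjP[j uv]; rewrite (traceE _ _ j); last first.
  by case: uv => -[-> ->] //; rewrite finset.setUC.
by case: uv => -[-> ->]; [exact: join|exact/is_polyline_sym/join].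
Qed.

End SubdividedGraph.

(** * The separator after the points *)

Lemma Bar_notin_nat_bits m : Bar \notin nat_bits m.
Proof.
rewrite /nat_bits; case: (bin_of_nat m) => // p.
by elim: p => [p IHp|p IHp|] /=; rewrite inE ?negb_or ?IHp
  -(inj_eq (can_inj symbol_codeK)) -val_eqE /= !inordK.
Qed.

(** Hence the first [Bar] of the input marks the end of the points, as [run_points] requires. *)
Lemma Bar_notin_enc_points m (loc : 'I_m -> rat * rat) : Bar \notin enc_points loc.
Proof.
have Bar_eq : ((Bar == Comma) = false) * ((Bar == Semicolon) = false) *
    ((Bar == Slash) = false) * ((Bar == Minus) = false).
  by do !split; apply/eqP.
have Bar_rat x : Bar \notin enc_rat x.
  rewrite /enc_rat !mem_cat inE !negb_or !Bar_notin_nat_bits Bar_eq.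
  by case: ifP; rewrite ?inE ?Bar_eq.
apply/flatten_mapP => -[i _]; rewrite /enc_point.
by do 2!rewrite mem_cat (negbTE (Bar_rat _)) inE Bar_eq.
Qed.

(** * The reduction and its correctness *)

Section Reduction.
Variable R : realType.

(** The arc drawing that witnesses planarity of the given graph is itself subdivided. *)
Lemma planar_half_edges (I : bpsewc_input R) :
  planar R (bigraph_graph (list_bigraph (half_edges (bpi_edges I)))).
Proof.
have [pos [trace [cf drawn]]] := bpi_planar I.
have [pos' [trace' [_ cf' drawn']]] := subdivide_drawing (bpi_edges_uniq I)
  (@is_arc_splits R) (@is_arc_sym R) (@is_arc_ends R) cf drawn.
by exists pos', trace'.
Qed.

(** The points and their order are kept, so the machine copies their encoding verbatim. *)
Definition subdivide_input (I : bpsewc_input R) : fm_input R :=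
  FMInput (uniq_half_edges (bpi_edges_lt I)) (planar_half_edges I)
    (@bpi_corr_inj R I).

Lemma subdivide_inputP k (I : bpsewc_input R) :
  bpsewc_drawable (2 * k + 1) (bpsewc_of_input I) <->
  fm_drawable k (fm_of_input (subdivide_input I)).
Proof.
split=> [[pos [trace [posE [cf drawn]]]]|[pos' [trace' [posE drawing]]]].
  have [pos' [trace' [posE' cf' drawn']]] := subdivide_drawing (bpi_edges_uniq I)
    (@is_polyline_splits R k) (@is_polyline_sym R k) (@is_polyline_ends R k) cf drawn.
  exists pos', trace'; split=> // v.
  exact: etrans (posE' v) (posE v).
have [trace drawing'] := merge_drawing (bpi_edges_uniq I) (bpi_edges_lt I) drawing.
by exists (fun u : 'I_(bpi_order I) => pos' (inl u)), trace; split.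
Qed.

End Reduction.

Theorem theorem2 (R : realType) (k : nat) :
  poly_reducible (bpsewc_problem R (2 * k + 1)) (fm_problem R k).
Proof.
exists (@subdivide_input R); split; last exact: subdivide_inputP.
exists subdivider, 4%N, 2%N => I.
exact/subdivider_computes/Bar_notin_enc_points.
Qed.
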